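(* Let $G$ be a locally finite acyclic directed graph with edge weights in a commutative ring, and let $\mathbf{u}=(u_1,\ldots,u_m)$ and $\mathbf{v}=(v_1,\ldots,v_n)$ be an $m$-tuple and an $n$-tuple of vertices of $G$ with $m\leq n$ (no parity condition on $m$). Then \[ \Bigg[\sum_{\sigma\in S_m}\operatorname{sgn}(\sigma)\operatorname{GF}[\mathscr{P}_0(\mathbf{u}_{\sigma},\mathbf{v})]\Bigg]^2=\det\Big[\operatorname{M}(\mathbf{u},\mathbf{v})\,U_{n}\,\operatorname{M}(\mathbf{u},\mathbf{v})^T\Big]=\det\Big[\operatorname{M}(\mathbf{u},\mathbf{v})\,U_{n}^T\,\operatorname{M}(\mathbf{u},\mathbf{v})^T\Big], \] where $U_n=[u_{i,j}]_{1\le i,j\le n}$ is the upper triangular matrix with $u_{i,j}=2$ if $i<j$, $u_{i,i}=1$, and $u_{i,j}=0$ if $i>j$. In particular, if $\mathbf{u}$ and $\mathbf{v}$ are compatible, then \[ \operatorname{GF}[\mathscr{P}_0(\mathbf{u},\mathbf{v})]^2=\det\Big[\operatorname{M}(\mathbf{u},\mathbf{v})U_{n}\operatorname{M}(\mathbf{u},\mathbf{v})^T\Big]=\det\Big[\operatorname{M}(\mathbf{u},\mathbf{v})U_{n}^T\operatorname{M}(\mathbf{u},\mathbf{v})^T\Big]. \]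
   Context: All paths are directed. The weight of a path is the product of the weights of its edges (a path of length zero has weight $1$); the weight of a tuple of paths is the product of the weights of its paths. A tuple of paths is nonintersecting if no two of its paths share a vertex. $\mathscr{P}(u,v)$ is the set of paths from $u$ to $v$ and $\operatorname{GF}[\mathscr{P}(u,v)]$ is the sum of their weights (these sums are assumed well defined; $\operatorname{GF}[\mathscr{P}(u,u)]=1$). The path matrix is the $m\times n$ matrix $\operatorname{M}(\mathbf{u},\mathbf{v})=\big[\operatorname{GF}[\mathscr{P}(u_i,v_j)]\big]_{1\le i\le m,1\le j\le n}$. For $\sigma\in S_m$, $\mathscr{P}_0(\mathbf{u}_\sigma,\mathbf{v})$ is the set of nonintersecting $m$-tuples of paths $(P_1,\ldots,P_m)$ such that $P_k\in\mathscr{P}(u_{\sigma(k)},v_{j_k})$ for some indices $j_1<\cdots<j_m$; $\operatorname{GF}$ of a set of tuples is the sum of their weights, and $\mathscr{P}_0(\mathbf{u},\mathbf{v})$ denotes the case $\sigma=\mathrm{id}$. The tuples $\mathbf{u}$ and $\mathbf{v}$ are compatible if for all $i<j$ in $[m]$ and $k<l$ in $[n]$, every path from $u_i$ to $v_l$ intersects every path from $u_j$ to $v_k$.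
   Formalization: Tuples in P_0 are counted together with their indices j_1<...<j_m (no change if the v_j are distinct; with repeated v_j, e.g. m=1, n=2, v_1=v_2, the formula fails otherwise); ''well defined'' means that finitely many paths from each u_i to each v_j have nonzero weight. *)

(* Defs.v *)
From HB Require Import structures.
From mathcomp Require Import all_boot all_order all_fingroup all_algebra.
From mathcomp Require Import boolp classical_sets functions cardinality fsbigop.

Set Implicit Arguments.
Unset Strict Implicit.
Unset Printing Implicit Defensive.

Import GRing.Theory.

Local Open Scope classical_set_scope.
Local Open Scope ring_scope.

(* Parallel edges are allowed; a simple digraph is the case where
   e |-> (src e, tgt e) is injective. *)
Record digraph := Digraph {
  vertex : choiceType;
  edge : choiceType;
  src : edge -> vertex;
  tgt : edge -> vertex }.

Arguments src {d} _.
Arguments tgt {d} _.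

Fixpoint joins (G : digraph) (x : vertex G) (s : seq (edge G)) (y : vertex G)
    : bool :=
  if s is e :: s' then (src e == x) && joins (tgt e) s' y else x == y.

(* A starting vertex and the successive edges. The starting vertex is recorded
   so that paths of length zero at different vertices are different. *)
Definition dpath (G : digraph) : choiceType := (vertex G * seq (edge G))%type.

Definition paths (G : digraph) (x y : vertex G) : set (dpath G) :=
  [set p | p.1 = x /\ joins p.1 p.2 y].

Definition path_vertices (G : digraph) (p : dpath G) : seq (vertex G) :=
  p.1 :: [seq tgt e | e <- p.2].

Definition intersect (G : digraph) (p q : dpath G) : Prop :=
  exists x, x \in path_vertices p /\ x \in path_vertices q.

Definition acyclic (G : digraph) : Prop :=
  forall (x : vertex G) (s : seq (edge G)), joins x s x -> s = [::].

Definition locally_finite (G : digraph) : Prop :=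
  forall x : vertex G, finite_set [set e : edge G | src e = x \/ tgt e = x].

Definition path_weight (R : comPzRingType) (G : digraph) (w : edge G -> R)
    (p : dpath G) : R :=
  \prod_(e <- p.2) w e.

Definition tuple_weight (R : comPzRingType) (G : digraph) (w : edge G -> R)
    (m : nat) (P : {ffun 'I_m -> dpath G}) : R :=
  \prod_(k < m) path_weight w (P k).

(* In a ring without topology a sum is well defined when it has finitely many
   nonzero terms. The sum below is 0 by convention when it is not. *)
Definition summable (R : comPzRingType) (T : choiceType) (wt : T -> R)
    (A : set T) : Prop :=
  finite_set [set x | A x /\ wt x <> 0].

Definition GF (R : comPzRingType) (T : choiceType) (wt : T -> R) (A : set T)
    : R :=
  \sum_(x \in A) wt x.

Definition path_matrix (R : comPzRingType) (G : digraph) (w : edge G -> R)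
    (m n : nat) (u : 'I_m -> vertex G) (v : 'I_n -> vertex G) : 'M[R]_(m, n) :=
  \matrix_(i, j) GF (path_weight w) (paths (u i) (v j)).

Definition nonintersecting (G : digraph) (m : nat)
    (P : {ffun 'I_m -> dpath G}) : Prop :=
  forall k l : 'I_m, k != l -> ~ intersect (P k) (P l).

Definition connects (G : digraph) (m n : nat) (u : 'I_m -> vertex G)
    (v : 'I_n -> vertex G) (j : {ffun 'I_m -> 'I_n})
    (P : {ffun 'I_m -> dpath G}) : Prop :=
  [/\ {homo j : k l / (k < l)%N},
      forall k, paths (u k) (v (j k)) (P k)
    & nonintersecting P].

(* The indices j_1 < ... < j_m of the end points are part of the data. If the
   v_j are pairwise distinct, they are determined by the paths (see GF_nipaths
   below). If v has repetitions, a tuple of paths has to be counted once for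
   each choice of indices, already for the formula to hold with m = 1, n = 2
   and v_1 = v_2. *)
Definition nipaths (G : digraph) (m n : nat) (u : 'I_m -> vertex G)
    (v : 'I_n -> vertex G)
    : set ({ffun 'I_m -> 'I_n} * {ffun 'I_m -> dpath G}) :=
  [set jP | connects u v jP.1 jP.2].

Definition GF_ni (R : comPzRingType) (G : digraph) (w : edge G -> R)
    (m n : nat) (u : 'I_m -> vertex G) (v : 'I_n -> vertex G) : R :=
  GF (fun jP => tuple_weight w jP.2) (nipaths u v).

Lemma joins_inj (G : digraph) (x : vertex G) s y z :
  joins x s y -> joins x s z -> y = z.
Proof.
elim: s x => [|e s IHs] x /=; first by move=> /eqP<- /eqP.
by move=> /andP[_ h1] /andP[_ h2]; exact: (IHs (tgt e)).
Qed.

Lemma GF_nipaths (R : comPzRingType) (G : digraph) (w : edge G -> R)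
    (m n : nat) (u : 'I_m -> vertex G) (v : 'I_n -> vertex G) :
  injective v ->
  GF_ni w u v =
    GF (fun P => tuple_weight w P)
       [set P : {ffun 'I_m -> dpath G} | exists j, connects u v j P].
Proof.
move=> v_inj; rewrite /GF_ni /GF.
have -> : [set P | exists j, connects u v j P] = snd @` nipaths u v.
  apply/seteqP; split=> [P [j jP]|P [[j Q] /= jQ <-]]; last by exists j.
  by exists (j, P).
rewrite fsbig_image // => -[j P] [k Q].
rewrite !inE => -[_ jP _] [_ kQ _] /= eqPQ.
congr pair => //; apply/ffunP=> i; apply: v_inj.
case: (jP i) (kQ i) => /= [_ h1] [_]; rewrite -eqPQ.
exact: joins_inj.
Qed.

Definition compatible (G : digraph) (m n : nat) (u : 'I_m -> vertex G)
    (v : 'I_n -> vertex G) : Prop :=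
  forall (i j : 'I_m) (k l : 'I_n), (i < j)%N -> (k < l)%N ->
  forall p q : dpath G, paths (u i) (v l) p -> paths (u j) (v k) q ->
  intersect p q.

Definition U_mx (R : comPzRingType) (n : nat) : 'M[R]_n :=
  \matrix_(i, j) if (i < j)%N then 2%:R else if i == j then 1 else 0.

(* Main.v *)
Require Import Defs.
From HB Require Import structures.
From mathcomp Require Import all_boot all_order all_fingroup all_algebra.
From mathcomp Require Import boolp classical_sets functions cardinality fsbigop.
From mathcomp Require Import ring zify.

(* Let f(M) be the sum of the maximal minors of M. Exchanging the initial parts
   of two paths at a common vertex cancels the intersecting tuples in the
   expansion of each maximal minor of the path matrix M, which leaves
   f(M) = sum_s sgn(s) GF[P_0(u_s, v)]; under compatibility only s = 1 remains.

   It remains to see that f(M)^2 = det(M U M^T). The key fact is that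
   f([y; N]) = f(N) * (sum of the entries of y) whenever N U y^T = 0. By
   induction det(N U N^T) = f(N)^2. When f(N) is not a zero divisor, a row operation makes
   the first row y of M satisfy N U y^T = 0; then M U M^T is block triangular
   with corner y U y^T, the square of the sum of the entries of y, and the two
   sides agree. The general case follows by specialising x to 1 in
   x M + (1 - x) B, where B is such that the values of f on it and on its lower
   rows are 1: a polynomial with constant term 1 is not a zero divisor. *)

Set Implicit Arguments.
Unset Strict Implicit.
Unset Printing Implicit Defensive.

Import GRing.Theory.

Local Open Scope ring_scope.

(** * Determinants of lists of rows *)

(** Sublists are listed by position, so equal entries count separately: two columns of a matrix may
    coincide. *)
Fixpoint subseqs (T : Type) (r : seq T) : seq (seq T) :=
  if r is x :: r' then map (cons x) (subseqs r') ++ subseqs r' else [:: [::]].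

Lemma subseqs_map (T U : Type) (f : T -> U) (r : seq T) :
  subseqs (map f r) = map (map f) (subseqs r).
Proof. by elim: r => //= x r ->; rewrite map_cat -!map_comp. Qed.

Lemma mem_subseqs (T : eqType) (r t : seq T) :
  (t \in subseqs r) = subseq t r.
Proof.
elim: r t => [|x r IHr] t /=; first by rewrite inE.
rewrite mem_cat IHr; case: t => [|y t]; first by rewrite sub0seq orbT.
have [->|neq] := eqVneq y x.
  rewrite mem_map ?IHr; last by move=> ? ? [].
  rewrite -[RHS]orbF; have [//|/=] := boolP (subseq t r).
  by apply: contraNF => h; apply: subseq_trans h; exact: subseq_cons.
by case: mapP => [[? _ []] /eqP|//]; rewrite (negPf neq).
Qed.

Lemma subseqs_uniq (T : eqType) (r : seq T) : uniq r -> uniq (subseqs r).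
Proof.
elim: r => //= x r IHr /andP[xr /IHr ur].
rewrite cat_uniq map_inj_uniq ?ur; last by move=> ? ? [].
rewrite andbT /=; apply/hasPn => t; rewrite mem_subseqs => tr.
apply: contra xr => /mapP[s _ ts]; apply: (mem_subseq tr).
by rewrite ts mem_head.
Qed.

Section RowDet.
Variable R : comPzRingType.

(* Lists of the wrong length get 0, so that a sum over all sublists is a sum
   over the sublists of length m. *)
Definition row_det (m : nat) (s : seq 'rV[R]_m) : R :=
  if size s == m then \det (\matrix_(k < m) nth 0 s k) else 0.

Lemma row_detD m (a b : seq 'rV[R]_m) k x y :
  row_det (a ++ (k *: x + y) :: b) =
    k * row_det (a ++ x :: b) + row_det (a ++ y :: b).
Proof.
rewrite /row_det !size_cat /=; case: eqP => [eqm|_]; last by rewrite mulr0 addr0.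
have ltm : (size a < m)%N by lia.
rewrite -[X in _ = _ + X]mul1r.
have other z z' : row' (Ordinal ltm) (\matrix_(i < m) nth 0 (a ++ z :: b) i) =
       row' (Ordinal ltm) (\matrix_(i < m) nth 0 (a ++ z' :: b) i).
  apply/matrixP=> i j; rewrite !mxE !nth_cat /=.
  case: ltnP => // le_ai; have := neq_lift (Ordinal ltm) i.
  rewrite -val_eqE /= => neq; congr ((_ : 'M_(_, _)) _ _).
  have : (0 < bump (size a) i - size a)%N by rewrite subn_gt0 ltn_neqAle neq.
  by case: (_ - _)%N.
apply: (@determinant_multilinear _ _ _ _ _ (Ordinal ltm)) => //.
by rewrite !rowK /= !nth_cat ltnn subnn /= scale1r.
Qed.

Lemma row_det_eq m (a b c : seq 'rV[R]_m) x :
  row_det (a ++ x :: b ++ x :: c) = 0.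
Proof.
rewrite /row_det; case: eqP => // /eqP.
rewrite size_cat /= size_cat /= => /eqP eqm.
have lt1 : (size a < m)%N by lia.
have lt2 : (size a + (size b).+1 < m)%N by lia.
apply: (@determinant_alternate _ _ _ (Ordinal lt1) (Ordinal lt2)).
  by rewrite -val_eqE /=; lia.
move=> j; rewrite !mxE /= !nth_cat ltnn subnn /= ltnNge leq_addr /=.
by rewrite addKn /= nth_cat ltnn subnn.
Qed.

(** Polarisation: with [x + y] in both adjacent rows the determinant vanishes, and so do two of the
    four terms of its expansion. *)
Lemma row_det_swap m (a b : seq 'rV[R]_m) x y :
  row_det (a ++ x :: y :: b) = - row_det (a ++ y :: x :: b).
Proof.
have := row_det_eq a [::] b (1 *: x + y); rewrite /= row_detD mul1r.
have D z := row_detD (rcons a z) b 1 x y; have := D x; have := D y; rewrite !cat_rcons => -> ->.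
rewrite (row_det_eq a [::] b x) (row_det_eq a [::] b y) !mul1r add0r addr0.
by move/eqP; rewrite addr_eq0 => /eqP.
Qed.

Lemma row_det_move m (p a b : seq 'rV[R]_m) x :
  row_det (p ++ x :: a ++ b) = (-1) ^+ size a * row_det (p ++ a ++ x :: b).
Proof.
elim: a p => [|y a IHa] p /=; first by rewrite mul1r.
by rewrite row_det_swap -cat_rcons IHa cat_rcons exprS mulN1r mulNr.
Qed.

Lemma row_det_unit m (s : seq 'rV[R]_(1 + m)) :
  row_det (row_mx 1%:M 0 :: s) = row_det (map rsubmx s).
Proof.
rewrite /row_det size_map /= eqSS; case: eqP => // eqm.
set A := \matrix_(k < _) _.
rewrite -[A]submxK.
have -> : ursubmx A = 0.
  by apply/matrixP=> i j; rewrite !mxE /= ord1 /= row_mxEr mxE.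
have -> : ulsubmx A = 1%:M.
  by apply/matrixP=> i j; rewrite mxE mxE mxE ord1 /= row_mxEl !mxE.
rewrite det_lblock det1 mul1r; congr (\det _).
apply/matrixP=> i j; rewrite !mxE /=.
by rewrite (nth_map 0) ?eqm // mxE.
Qed.

Lemma row_det_zero m (s : seq 'rV[R]_m) :
  row_det (map (row_mx (0 : 'M_1)) s) = 0.
Proof.
rewrite /row_det size_map; case: eqP => // eqm.
rewrite (expand_det_col _ (lshift m 0)) big1 // => i _.
by rewrite !mxE (nth_map 0) ?eqm // row_mxEl mxE mul0r.
Qed.

Definition head_sum m (r : seq 'rV[R]_(1 + m)) : R :=
  \sum_(c <- r) lsubmx c 0 0.

(* This is N *m U *m y^T when the rows of r are the columns of col_mx y N. *)
Fixpoint head_comb m (r : seq 'rV[R]_(1 + m)) : 'rV[R]_m :=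
  if r is c :: r' then
    (lsubmx c 0 0 + 2%:R * head_sum r') *: rsubmx c + head_comb r'
  else 0.

(* The prefix zs makes the induction on r go through: splitting off the head
   of r moves it to the end of zs. *)
Lemma sum_row_det m (r : seq 'rV[R]_(1 + m)) (zs : seq 'rV[R]_m) :
  \sum_(t <- subseqs r) row_det (map (row_mx 0) zs ++ t)
  + \sum_(t <- subseqs r) row_det (head_comb r :: zs ++ map rsubmx t)
  = (-1) ^+ size zs * head_sum r
    * \sum_(t <- subseqs r) row_det (zs ++ map rsubmx t).
Proof.
elim: r zs => [|c r IHr] zs.
  rewrite !big_seq1 /= /head_sum big_nil !cats0 row_det_zero mulr0 mul0r add0r.
  (* A zero row is -1 times a zero row plus a zero row, so linearity makes the determinant
     vanish. *)
  have := row_detD [::] zs (-1) 0 0; rewrite scaler0 addr0 /= => ->.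
  by rewrite mulN1r addNr.
rewrite [subseqs _]/= !big_cat !big_map /=.
have -> : head_sum (c :: r) = lsubmx c 0 0 + head_sum r.
  by rewrite /head_sum big_cons.
set y := lsubmx c 0 0; set s := head_sum r; set x := rsubmx c.
have defc : c = y *: row_mx 1%:M 0 + row_mx 0 x.
  rewrite -[LHS]hsubmxK scale_row_mx scaler0 add_row_mx add0r addr0.
  by congr row_mx; rewrite [LHS]mx11_scalar scale_scalar_mx mulr1.
(* The unit part of [c] moves to the front past the prefix rows and strips the first column; the
   other part of [c] joins the prefix. *)
have E1 : \sum_(t <- subseqs r) row_det (map (row_mx 0) zs ++ c :: t) =
    y * ((-1) ^+ size zs * \sum_(t <- subseqs r) row_det (zs ++ map rsubmx t))
    + \sum_(t <- subseqs r) row_det (map (row_mx 0) (rcons zs x) ++ t).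
  rewrite !mulr_sumr -big_split /=; apply: eq_bigr => t _.
  rewrite {1}defc row_detD map_rcons cat_rcons; congr (y * _ + _).
  have := row_det_move [::] (map (row_mx 0) zs) t (row_mx 1%:M 0).
  rewrite size_map /= row_det_unit map_cat mapK; last exact: row_mxKr.
  by move=> ->; rewrite mulrA -expr2 sqrr_sign mul1r.
(* The row [x] occurs again further down, so its multiple in the first row contributes nothing. *)
have E2 (a : R) : \sum_(t <- subseqs r)
     row_det ((a *: x + head_comb r) :: zs ++ x :: map rsubmx t) =
    \sum_(t <- subseqs r) row_det (head_comb r :: rcons zs x ++ map rsubmx t).
  apply: eq_bigr => t _; rewrite (row_detD [::]) (row_det_eq [::]).
  by rewrite mulr0 add0r cat_rcons.
have E3 (a : R) : \sum_(t <- subseqs r)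
     row_det ((a *: x + head_comb r) :: zs ++ map rsubmx t) =
    a * ((-1) ^+ size zs *
      \sum_(t <- subseqs r) row_det (rcons zs x ++ map rsubmx t))
    + \sum_(t <- subseqs r) row_det (head_comb r :: zs ++ map rsubmx t).
  rewrite !mulr_sumr -big_split /=; apply: eq_bigr => t _.
  by rewrite (row_detD [::]) /= (row_det_move [::] zs) cat_rcons.
have E4 : \sum_(t <- subseqs r) row_det (zs ++ x :: map rsubmx t) =
    \sum_(t <- subseqs r) row_det (rcons zs x ++ map rsubmx t).
  by apply: eq_bigr => t _; rewrite cat_rcons.
rewrite E1 E2 E3 E4.
(* Up to a common sign, the hypothesis for [rcons zs x] contributes -s against the coefficient y +
   2s from E3, which leaves y + s, the head sum of [c :: r]. This is what the 2 in [U_mx] is for. *)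
have I1 := IHr zs; have I2 := IHr (rcons zs x).
rewrite size_rcons exprS -/s in I2; rewrite -/s in I1.
move: I1 I2.
set u1 := \sum_(t <- _) _; set u2 := \sum_(t <- _) _.
set u3 := \sum_(t <- _) _; set u4 := \sum_(t <- _) _.
set u5 := \sum_(t <- _) _; set u6 := \sum_(t <- _) _.
move=> /(canRL (addrK _)) -> /(canRL (addrK _)) ->; ring.
Qed.
End RowDet.

(** * The sum of the maximal minors *)

Definition increasing (m n : nat) (j : {ffun 'I_m -> 'I_n}) : bool :=
  [forall k : 'I_m, forall l : 'I_m, (k < l)%N ==> (j k < j l)%N].

Lemma increasingP (m n : nat) (j : {ffun 'I_m -> 'I_n}) :
  reflect {homo j : k l / (k < l)%N} (increasing j).
Proof.
apply: (iffP forallP) => [h k l lt_kl|h k].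
  by have /forallP/(_ l)/implyP := h k; apply.
by apply/forallP=> l; apply/implyP/h.
Qed.

Definition ltn_ord_rel n : rel 'I_n := relpre val ltn.

Lemma sorted_enum_ord n : sorted (@ltn_ord_rel n) (enum 'I_n).
Proof. by rewrite -sorted_map val_enum_ord iota_ltn_sorted. Qed.

Lemma ltn_ord_trans n : transitive (@ltn_ord_rel n).
Proof. by move=> x y z; exact: ltn_trans. Qed.

Definition index_seq (m n : nat) (j : {ffun 'I_m -> 'I_n}) : seq 'I_n :=
  [seq j k | k <- enum 'I_m].

Lemma size_index_seq (m n : nat) (j : {ffun 'I_m -> 'I_n}) :
  size (index_seq j) = m.
Proof. by rewrite size_map size_enum_ord. Qed.

Lemma nth_index_seq (m n : nat) (j : {ffun 'I_m -> 'I_n}) x0 (k : 'I_m) :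
  nth x0 (index_seq j) k = j k.
Proof. by rewrite (nth_map k) ?size_enum_ord // nth_ord_enum. Qed.

Lemma sorted_index_seq (m n : nat) (j : {ffun 'I_m -> 'I_n}) :
  sorted (@ltn_ord_rel n) (index_seq j) = increasing j.
Proof.
apply/idP/increasingP => [srt k l lt_kl|incr]; last first.
  by rewrite /index_seq; apply: homo_sorted (sorted_enum_ord m) => x y; exact: incr.
have := sorted_ltn_nth (@ltn_ord_trans n) (j k) srt.
have lt (i : 'I_m) : (i < size (index_seq j))%N by rewrite size_map size_enum_ord.
move=> /(_ k l (lt k) (lt l) lt_kl).
by rewrite !nth_index_seq.
Qed.

(** Links the two indexings of the maximal minors. A strictly sorted list is determined by its
    members, hence is a filter of the enumeration; conversely a sublist of a sorted list is
    sorted. *)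
Lemma mem_increasing (m n : nat) (t : seq 'I_n) :
  (t \in [seq index_seq j | j <- enum {ffun 'I_m -> 'I_n} & increasing j]) =
    (size t == m) && (t \in subseqs (enum 'I_n)).
Proof.
rewrite mem_subseqs; apply/mapP/andP => [[j]|[szt sub_t]].
  rewrite mem_filter -sorted_index_seq => /andP[srt _] ->; split.
    by rewrite size_index_seq.
  suff -> : index_seq j = filter (mem (index_seq j)) (enum 'I_n).
    exact: filter_subseq.
  apply: (irr_sorted_eq (@ltn_ord_trans n)) => //.
  - by move=> x; exact: ltnn.
  - exact: (sorted_filter (@ltn_ord_trans n) _ (sorted_enum_ord n)).
  - by move=> x; rewrite mem_filter mem_enum andbT.
have deft : t = index_seq [ffun k => tnth (Tuple szt) k].
  rewrite /index_seq; under eq_map do rewrite ffunE.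
  by rewrite map_tnth_enum.
exists [ffun k => tnth (Tuple szt) k] => //.
rewrite mem_filter mem_enum andbT -sorted_index_seq -deft.
exact: (subseq_sorted (@ltn_ord_trans n) sub_t (sorted_enum_ord n)).
Qed.

Section MinorSum.
Variable R : comPzRingType.

Definition minor_sum (m n : nat) (M : 'M[R]_(m, n)) : R :=
  \sum_(j : {ffun 'I_m -> 'I_n} | increasing j) \det (colsub j M).

Lemma minor_sumE (m n : nat) (M : 'M[R]_(m, n)) :
  minor_sum M = \sum_(t <- subseqs [seq row i M^T | i <- enum 'I_n]) row_det t.
Proof.
rewrite subseqs_map big_map (bigID (fun t => size t == m)) /=.
rewrite [X in _ = _ + X]big1 ?addr0; last first.
  by move=> t neq; rewrite /row_det size_map (negPf neq).
rewrite -big_filter.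
rewrite (perm_big [seq index_seq j | j <- enum {ffun 'I_m -> 'I_n} & increasing j]).
  rewrite big_map big_filter big_enum_cond /minor_sum; apply: eq_big => // j _.
  rewrite /row_det size_map size_index_seq eqxx -det_tr; congr (\det _).
  apply/matrixP=> k l; rewrite [RHS]mxE (nth_map (j k)) ?size_index_seq //.
  by rewrite nth_index_seq !mxE.
apply: uniq_perm.
- exact: filter_uniq (subseqs_uniq (enum_uniq _)).
- rewrite map_inj_in_uniq ?(filter_uniq _ (enum_uniq _)) //.
  move=> j j' _ _ eqj; apply/ffunP=> k.
  have := congr1 (fun s => nth (j k) s k) eqj.
  by rewrite !nth_index_seq.
by move=> t; rewrite mem_filter mem_increasing.
Qed.

Lemma minor_sum_mull (m n : nat) (P : 'M[R]_m) (M : 'M[R]_(m, n)) :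
  minor_sum (P *m M) = \det P * minor_sum M.
Proof.
rewrite mulr_sumr; apply: eq_bigr => j _.
by rewrite -det_mulmx mulmx_colsub.
Qed.

Lemma minor_sum0 (n : nat) (M : 'M[R]_(0, n)) : minor_sum M = 1.
Proof.
have j0 : {ffun 'I_0 -> 'I_n} by apply: finfun => -[].
rewrite /minor_sum (big_pred1 j0) ?det_mx00 // => j /=.
have -> : j = j0 by apply/ffunP => -[].
by rewrite eqxx; apply/increasingP => -[].
Qed.

(** Sortedness makes the recursion produce a triangular matrix: the head [c] has coefficient 1 on
    itself and 2 on each later index, while the rows of later indices have coefficient 0 at [c]. *)
Lemma head_comb_sorted (m n : nat) (y : 'rV[R]_n) (N : 'M[R]_(m, n))
    (s : seq 'I_n) :
  sorted (@ltn_ord_rel n) s ->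
  head_comb [seq row i (col_mx y N)^T | i <- s] =
    \sum_(i <- s) \sum_(l <- s) (U_mx R n i l * y 0 l) *: row i N^T.
Proof.
have l_row i : lsubmx (row i (col_mx y N)^T) 0 0 = y 0 i.
  by rewrite mxE mxE mxE col_mxEu.
elim: s => [|c s IHs] srt; first by rewrite big_nil.
have /allP ltc := order_path_min (@ltn_ord_trans n) srt.
rewrite /= IHs ?(path_sorted srt) // /head_sum big_map l_row !big_cons.
have -> : rsubmx (row c (col_mx y N)^T) = row c N^T.
  by apply/rowP=> k; do 3!rewrite [LHS]mxE; rewrite col_mxEd !mxE.
congr (_ + _).
  rewrite scalerDl !mxE ltnn eqxx mul1r; congr (_ + _).
  rewrite mulr_sumr scaler_suml big_seq [RHS]big_seq.
  by apply: eq_bigr => l /ltc lt_cl; rewrite l_row mxE ifT.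
rewrite big_seq [RHS]big_seq; apply: eq_bigr => i /ltc lt_ci.
rewrite big_cons !mxE ltnNge ltnW //= -val_eqE gtn_eqF //.
by rewrite mul0r scale0r add0r.
Qed.

(** This is [sum_row_det] with empty prefix: the extra row in its second sum is the transpose of
    [N *m U_mx R n *m y^T], so that sum vanishes. *)
Lemma minor_sum_col (m n : nat) (y : 'rV[R]_n) (N : 'M[R]_(m, n)) :
  N *m U_mx R n *m y^T = 0 ->
  minor_sum (col_mx y N) = minor_sum N * \sum_j y 0 j.
Proof.
move=> orth; rewrite !minor_sumE.
have := sum_row_det [seq row i (col_mx y N)^T | i <- enum 'I_n] [::].
rewrite head_comb_sorted ?sorted_enum_ord // big_enum /=.
have -> : \sum_(i : 'I_n) \sum_(l <- enum 'I_n)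
         (U_mx R n i l * y 0 l) *: row i N^T = (N *m U_mx R n *m y^T)^T.
  apply/rowP=> k; rewrite -mulmxA !mxE summxE; apply: eq_bigr => i _.
  rewrite big_enum summxE !mxE mulr_sumr; apply: eq_bigr => l _.
  by rewrite !mxE mulrC.
rewrite orth trmx0 [X in _ + X]big1 => [|t _]; last first.
  have := row_detD [::] (map rsubmx t) (-1) 0 0; rewrite scaler0 addr0 /= => ->.
  by rewrite mulN1r addNr.
rewrite addr0 => ->; rewrite mul1r mulrC /head_sum big_map big_enum /=.
congr (_ * _).
  transitivity (\sum_(t <- map (map rsubmx)
      (subseqs [seq row i (col_mx y N)^T | i <- enum 'I_n])) row_det t).
    by rewrite big_map.
  rewrite -subseqs_map -map_comp; congr (\sum_(t <- subseqs _) _).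
  by apply: eq_map => i; apply/rowP=> k; do 3!rewrite [LHS]mxE; rewrite col_mxEd !mxE.
by apply: eq_bigr => i _; rewrite mxE mxE mxE col_mxEu.
Qed.

(** U minus the all-ones matrix is alternating, with 1 above and -1 below the diagonal, so its
    quadratic form is zero. *)
Lemma quad_U_mx (n : nat) (y : 'rV[R]_n) :
  (y *m U_mx R n *m y^T) 0 0 = (\sum_j y 0 j) ^+ 2.
Proof.
rewrite expr2 mulr_suml mxE.
under eq_bigr => l _ do rewrite mxE [y^T _ _]mxE mulr_suml.
under [RHS]eq_bigr => i _ do rewrite mulr_sumr.
rewrite exchange_big /=.
apply/eqP; rewrite -subr_eq0 -sumrB; apply/eqP.
under eq_bigr => i _ do rewrite -sumrB.
pose F (i l : 'I_n) : R := (if (i < l)%N then y 0 i * y 0 l else 0)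
                - (if (l < i)%N then y 0 l * y 0 i else 0).
transitivity (\sum_i \sum_l F i l).
  apply: eq_bigr => i _; apply: eq_bigr => l _; rewrite !mxE /F -val_eqE.
  by case: ltngtP => //= _; ring.
under eq_bigr => i _ do rewrite sumrB.
by rewrite sumrB [X in _ - X]exchange_big subrr.
Qed.
End MinorSum.

(** * The squared sum of maximal minors as a determinant *)

Section Square.
Variable n : nat.

Lemma map_minor_sum (R S : comPzRingType) (f : {rmorphism R -> S}) (m : nat)
    (M : 'M[R]_(m, n)) : minor_sum (map_mx f M) = f (minor_sum M).
Proof.
rewrite /minor_sum rmorph_sum; apply: eq_bigr => j _.
by rewrite -map_mxsub det_map_mx.
Qed.

Lemma map_U_mx (R S : comPzRingType) (f : {rmorphism R -> S}) :
  map_mx f (U_mx R n) = U_mx S n.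
Proof.
apply/matrixP=> i j; rewrite !mxE.
by do 2?case: ifP => _; rewrite ?rmorph_nat ?rmorph1 ?rmorph0.
Qed.

(** Collects, for every proper block of lower rows, the cancellation that the induction on the
    number of rows performs. *)
Fixpoint regular_tails (R : comPzRingType) (m : nat) : 'M[R]_(m, n) -> Prop :=
  if m is m'.+1 return 'M[R]_(m, n) -> Prop then
    fun M : 'M[R]_(1 + m', n) =>
      GRing.lreg (minor_sum (dsubmx M)) /\ regular_tails (dsubmx M)
  else fun=> True.

(* With N the lower rows of M and d = det (N U N^T), which is regular, replacing
   the first row y of M by y' = d y - (adj (N U N^T) N U y^T)^T N multiplies
   both square roots by d and achieves N U y'^T = 0. *)
Lemma det_U_regular (R : comPzRingType) (m : nat) (M : 'M[R]_(m, n)) :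
  regular_tails M -> \det (M *m U_mx R n *m M^T) = minor_sum M ^+ 2.
Proof.
elim: m M => [|m IHm] M; first by rewrite minor_sum0 expr1n det_mx00.
move: M => /= M0; set M : 'M[R]_(1 + m, n) := M0 => -[reg /IHm].
set N := dsubmx M; set U := U_mx R n; set Y := N *m U *m N^T => detY.
set d := \det Y in detY *.
pose y := usubmx M; pose lam := (\adj Y *m (N *m U *m y^T))^T.
pose y' := d *: y - lam *m N.
have orth : N *m U *m y'^T = 0.
  rewrite /y' linearB /= linearZ /= trmx_mul trmxK mulmxBr -scalemxAr.
  by rewrite 2!mulmxA -/Y mul_mx_adj mul_scalar_mx subrr.
pose P : 'M[R]_(1 + m) := block_mx d%:M (- lam) 0 1%:M.
have PM : P *m M = col_mx y' N.
  rewrite -[M]vsubmxK -/y -/N mul_block_col mul_scalar_mx mulNmx mul0mx add0r.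
  by rewrite mul1mx.
have detP : \det P = d by rewrite det_ublock det_scalar1 det1 mulr1.
have fM : d * minor_sum M = minor_sum N * \sum_j y' 0 j.
  by rewrite -minor_sum_col // -PM minor_sum_mull detP.
(* The factor [P] enters on both sides, whence the square of [d]; by [orth] the product for
   [col_mx y' N] is block triangular. *)
have DM : d ^+ 2 * \det (M *m U *m M^T) = (\sum_j y' 0 j) ^+ 2 * d.
  transitivity (\det (P *m M *m U *m (P *m M)^T)).
    by rewrite trmx_mul !mulmxA -!(mulmxA P) det_mulmx det_mulmx det_tr detP; ring.
  rewrite PM tr_col_mx mul_col_mx mul_col_row orth det_ublock -/Y -/d.
  by rewrite det_mx11 quad_U_mx.
(* By induction [d] is the square of the regular element [minor_sum N]. *)
have regd : GRing.lreg (d ^+ 2).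
  by rewrite detY; do 2!apply: GRing.lregX.
apply: regd; rewrite DM -exprMn fM exprMn -detY; ring.
Qed.

(** If p q = 0, coefficient k of the product is that of q plus multiples of lower coefficients of q,
    so all of them vanish by strong induction. *)
Lemma lreg_horner0 (R : comNzRingType) (p : {poly R}) :
  p.[0] = 1 -> GRing.lreg p.
Proof.
rewrite horner_coef0 => p0 q1 q2 /eqP; rewrite -subr_eq0 -mulrBr => /eqP pq.
apply/eqP; rewrite -subr_eq0; apply/eqP; move: (q1 - q2) pq => q pq.
apply/polyP=> k; rewrite coef0; elim/ltn_ind: k => k IHk.
have := congr1 (fun r : {poly R} => r`_k) pq.
rewrite /= coef0 coefM big_ord_recl /= p0 mul1r subn0 big1 ?addr0 // => i _.
by rewrite IHk ?mulr0 //=; rewrite /bump /=; have := ltn_ord i; lia.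
Qed.

(** For m <= n these are the last rows of the identity matrix, chosen so that deleting the first row
    stays within the family. *)
Definition last_rows (R : comPzRingType) (m : nat) : 'M[R]_(m, n) :=
  \matrix_(i, j) ((j : nat) == (n - m + i)%N)%:R.

Lemma dsubmx_last_rows (R : comPzRingType) (m : nat) : (m < n)%N ->
  dsubmx (last_rows R (1 + m)) = last_rows R m.
Proof.
by move=> lt_mn; apply/matrixP=> i j; rewrite !mxE /=; congr (_ == _)%:R; lia.
Qed.

(** The first row is a unit vector supported to the left of all lower rows. As U is upper
    triangular, the orthogonality in [minor_sum_col] holds and each row contributes a factor 1. *)
Lemma minor_sum_last_rows (R : comPzRingType) (m : nat) :
  (m <= n)%N -> minor_sum (last_rows R m) = 1.
Proof.
elim: m => [|m IHm] le_mn; first exact: minor_sum0.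
rewrite -[last_rows R m.+1](@vsubmxK _ 1 m) dsubmx_last_rows //.
have lt_n : (n - m.+1 < n)%N by lia.
set y := usubmx _.
have yE j : y 0 j = (j == Ordinal lt_n)%:R.
  by rewrite !mxE /= addn0.
rewrite minor_sum_col.
  rewrite IHm ?(ltnW le_mn) // mul1r (bigD1 (Ordinal lt_n)) //= yE eqxx.
  by rewrite big1 ?addr0 // => j /negPf neq; rewrite yE neq.
apply/matrixP=> i k; rewrite ord1 -mulmxA [LHS]mxE [RHS]mxE big1 // => l _.
rewrite [X in _ * X]mxE (bigD1 (Ordinal lt_n)) //= [y^T _ _]mxE yE eqxx mulr1.
rewrite big1 ?addr0 => [|j /negPf neq]; last by rewrite [y^T _ _]mxE yE neq mulr0.
rewrite !mxE; case: eqP => [eql|_]; last by rewrite mul0r.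
by rewrite -val_eqE /= !ifF ?mulr0 //; lia.
Qed.

Definition deform (R : comNzRingType) (m : nat) (M : 'M[R]_(m, n)) :
    'M[{poly R}]_(m, n) :=
  'X *: map_mx polyC M + (1 - 'X) *: map_mx polyC (last_rows R m).

Lemma deform_horner (R : comNzRingType) (m : nat) (M : 'M[R]_(m, n)) (a : R) :
  map_mx (horner_eval a) (deform M) = a *: M + (1 - a) *: last_rows R m.
Proof.
apply/matrixP=> i j; rewrite !mxE /= /horner_eval.
by rewrite hornerD !hornerM hornerD hornerN !hornerC hornerX.
Qed.

(** At 0 the deformation becomes [last_rows], so its sum of minors has constant term 1; its lower
    rows are again a deformation. *)
Lemma regular_tails_deform (R : comNzRingType) (m : nat) (M : 'M[R]_(m, n)) :
  (m <= n)%N -> regular_tails (deform M).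
Proof.
elim: m M => //= m IHm M lt_mn.
have -> : dsubmx (deform M : 'M_(1 + m, n)) = deform (dsubmx (M : 'M_(1 + m, n))).
  rewrite /deform -(dsubmx_last_rows _ lt_mn).
  by apply/matrixP=> i j; rewrite !mxE.
split; last exact: IHm (ltnW lt_mn).
apply: lreg_horner0; rewrite -[LHS]/(horner_eval 0 _) -map_minor_sum.
by rewrite deform_horner scale0r add0r subr0 scale1r minor_sum_last_rows // ltnW.
Qed.

Lemma det_U_nz (R : comNzRingType) (m : nat) (M : 'M[R]_(m, n)) :
  (m <= n)%N -> \det (M *m U_mx R n *m M^T) = minor_sum M ^+ 2.
Proof.
move=> le_mn.
have MM : map_mx (horner_eval 1) (deform M) = M.
  by rewrite deform_horner scale1r subrr scale0r addr0.
have := congr1 (horner_eval 1) (det_U_regular (regular_tails_deform M le_mn)).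
rewrite rmorphXn /= -map_minor_sum MM => <-.
by rewrite -det_map_mx !map_mxM -map_trmx map_U_mx MM.
Qed.

(** The polynomial argument runs over a nonzero ring; in the zero ring any two elements agree. *)
Lemma det_U (R : comPzRingType) (m : nat) (M : 'M[R]_(m, n)) :
  (m <= n)%N -> \det (M *m U_mx R n *m M^T) = minor_sum M ^+ 2.
Proof.
move=> le_mn; have [R1|R1] := eqVneq (1 : R) 0.
  by rewrite -[LHS]mulr1 -[RHS]mulr1 R1 !mulr0.
pose S := HB.pack_for comNzRingType R (GRing.PzSemiRing_isNonZero.Build R R1).
exact: (@det_U_nz S m M le_mn).
Qed.
End Square.

(** * Sums with finite support *)

Local Open Scope classical_set_scope.

Section FiniteSums.
Variable R : comPzRingType.

Lemma GF_seq (T : choiceType) (wt : T -> R) (A : set T) (r : seq T) :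
  uniq r -> (forall x, A x -> wt x <> 0 -> x \in r) ->
  GF wt A = \sum_(x <- r | x \in A) wt x.
Proof.
move=> ur Ar; rewrite /GF (fsbigE (filter (mem A) r)).
- rewrite big_filter_cond; apply: eq_bigl => x /=; exact: andbb.
- exact: filter_uniq.
- by move=> x /=; rewrite mem_filter => /andP[/set_mem].
move=> x Ax; apply: contraNeq => /eqP wx.
by rewrite mem_filter Ar // andbT; exact: mem_set.
Qed.

(** One finite list serves all members of a finite family, so that sums over sets become big
    operators over the same list. *)
Lemma common_support (I : finType) (T : choiceType) (wt : I -> T -> R)
    (A : I -> set T) : (forall i, summable (wt i) (A i)) ->
  exists2 r : seq T, uniq r & forall i x, A i x -> wt i x <> 0 -> x \in r.
Proof.
move=> sA.
have fin : finite_set (\bigcup_(i in [set: I]) [set x | A i x /\ wt i x <> 0]).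
  by apply: bigcup_finite => [|i _]; [exact: finite_finset|exact: sA].
have /finite_seqP[r defr] := fin; exists (undup r); first exact: undup_uniq.
move=> i x Ax wx; rewrite mem_undup.
have : (\bigcup_(i in [set: I]) [set x | A i x /\ wt i x <> 0]) x by exists i.
by rewrite defr.
Qed.

Lemma summable_seq (T : choiceType) (wt : T -> R) (A : set T) (r : seq T) :
  (forall x, A x -> wt x <> 0 -> x \in r) -> summable wt A.
Proof.
by move=> Ar; apply: sub_finite_set (finite_seq r) => x [Ax wx]; exact: Ar.
Qed.

Lemma summable_sub (T : choiceType) (wt : T -> R) (A B : set T) :
  A `<=` B -> summable wt B -> summable wt A.
Proof. by move=> AB; apply: sub_finite_set => x [/AB]. Qed.

Lemma GF_setID (T : choiceType) (wt : T -> R) (A B : set T) :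
  summable wt A -> GF wt A = GF wt (A `&` B) + GF wt (A `&` ~` B).
Proof.
move=> sA; have [r ur Ar] := @common_support unit _ (fun=> wt) (fun=> A) (fun=> sA).
rewrite !(GF_seq ur); [|by move=> x [? _]; exact: (Ar tt)..|exact: (Ar tt)].
rewrite (bigID (mem B)) /=; congr (_ + _); apply: eq_bigl => x.
  by rewrite in_setI.
by rewrite in_setI in_setC.
Qed.

Lemma GF_pair (I : finType) (T : choiceType) (wt : I * T -> R)
    (A : set (I * T)) :
  (forall i, summable (fun t => wt (i, t)) [set t | A (i, t)]) ->
  GF wt A = \sum_i GF (fun t => wt (i, t)) [set t | A (i, t)].
Proof.
move=> sA; have [r ur Ar] := common_support sA.
rewrite (@GF_seq _ _ _ [seq (i, t) | i <- enum I, t <- r]).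
- rewrite big_mkcond big_allpairs big_enum /=; apply: eq_bigr => i _.
  rewrite -big_mkcond (GF_seq ur) => [|x]; last exact: Ar.
  by apply: eq_bigl => x; apply/idP/idP => /set_mem; rewrite inE.
- by rewrite allpairs_uniq ?enum_uniq // => -[i x] [i' x'].
move=> [i x] Aix wix; apply/allpairsP; exists (i, x).
by rewrite mem_enum /=; split=> //; exact: Ar wix.
Qed.

Lemma prodr_neq0 (I : finType) (F : I -> R) (i : I) :
  \prod_k F k <> 0 -> F i <> 0.
Proof. by move=> nz Fi; apply: nz; rewrite (bigD1 i) //= Fi mul0r. Qed.

(** A nonzero product has nonzero factors, so the entries of a contributing tuple lie in one finite
    list [r]. Tuples of positions in [r] then allow the finite distributive law. *)
Lemma GF_prod (m : nat) (T : choiceType) (wt : T -> R) (A : 'I_m -> set T) :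
  (forall k, summable wt (A k)) ->
  summable (fun P : {ffun 'I_m -> T} => \prod_k wt (P k))
    [set P | forall k, A k (P k)]
  /\ \prod_k GF wt (A k) = GF (fun P : {ffun 'I_m -> T} => \prod_k wt (P k))
    [set P | forall k, A k (P k)].
Proof.
move=> sA; have [r ur Ar] := common_support sA.
pose at_ (i : 'I_(size r)) := tnth (in_tuple r) i.
pose h (f : {ffun 'I_m -> 'I_(size r)}) := [ffun k => at_ (f k)].
have supp (P : {ffun 'I_m -> T}) : [set P | forall k, A k (P k)] P ->
    \prod_k wt (P k) <> 0 -> P \in map h (enum {ffun 'I_m -> 'I_(size r)}).
  move=> /= AP wP.
  have Pr k : P k \in r by apply: Ar (AP k) _; exact: prodr_neq0 wP.
  apply/mapP; exists [ffun k => Ordinal (etrans (index_mem _ _) (Pr k))].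
    by rewrite mem_enum.
  by apply/ffunP=> k; rewrite !ffunE /at_ (tnth_nth (P k)) /= nth_index.
split; first exact: summable_seq supp.
rewrite (GF_seq _ supp); last first.
  rewrite map_inj_uniq ?enum_uniq // => f g /ffunP eqfg; apply/ffunP=> k.
  have := eqfg k; rewrite !ffunE /at_ !(tnth_nth (at_ (f k))) => /eqP.
  by rewrite nth_uniq // => /eqP/val_inj.
transitivity (\prod_k \sum_(i < size r | at_ i \in A k) wt (at_ i)).
  apply: eq_bigr => k _; rewrite (GF_seq ur) => [|x]; last exact: Ar.
  by rewrite big_tnth.
rewrite bigA_distr_big_dep big_map big_enum_cond; apply: eq_big => f.
  apply/familyP/idP => [fA|/set_mem Af k].
    by apply/mem_set => k; rewrite ffunE; apply/set_mem/fA.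
  by apply/mem_set; have := Af k; rewrite ffunE.
by move=> _; apply: eq_bigr => k _; rewrite ffunE.
Qed.
End FiniteSums.

(** * Exchanging initial parts of paths *)

Section Splice.
Variable G : digraph.
Implicit Types (p q : dpath G) (x y : vertex G).

Lemma joins_cat (a b : vertex G) s t :
  joins a (s ++ t) b =
    joins a s (last a (map tgt s)) && joins (last a (map tgt s)) t b.
Proof.
by elim: s a => [a|e s IHs a] /=; rewrite ?eqxx // IHs andbA.
Qed.

(* The first visit of p to x is after position p x edges. *)
Definition position p x : nat := index x (path_vertices p).

Lemma position_le p x : x \in path_vertices p -> (position p x <= size p.2)%N.
Proof. by rewrite -index_mem /= size_map ltnS. Qed.

Lemma take_vertices p x :
  take (position p x).+1 (path_vertices p) =
    p.1 :: map tgt (take (position p x) p.2).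
Proof. by rewrite /= map_take. Qed.

Lemma last_position p x : x \in path_vertices p ->
  last p.1 (map tgt (take (position p x) p.2)) = x.
Proof.
move=> xp; have := position_le xp; rewrite -{3}(nth_index p.1 xp) -/(position p x).
move=> le_p; rewrite (last_nth p.1) -take_vertices size_map size_takel //.
by rewrite nth_take.
Qed.

Definition splice x p q : dpath G :=
  (p.1, take (position p x) p.2 ++ drop (position q x) q.2).

Lemma splice_paths x p q a b c d :
  x \in path_vertices p -> x \in path_vertices q ->
  paths a b p -> paths c d q -> paths a d (splice x p q).
Proof.
move=> xp xq [pa pb] [qc qd]; split=> //=.
rewrite joins_cat last_position //; apply/andP; split.
  move: pb; rewrite -{1}(cat_take_drop (position p x) p.2) joins_cat.
  by rewrite last_position // => /andP[].
move: qd; rewrite -{1}(cat_take_drop (position q x) q.2) joins_cat.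
by rewrite last_position // => /andP[].
Qed.

Lemma splice_vertices x p q :
  path_vertices (splice x p q) =
    (p.1 :: map tgt (take (position p x) p.2))
    ++ map tgt (drop (position q x) q.2).
Proof. by rewrite /path_vertices /= map_cat. Qed.

Lemma mem_head_position x p : x \in path_vertices p ->
  x \in p.1 :: map tgt (take (position p x) p.2).
Proof. by move=> xp; rewrite -{1}(last_position xp) mem_last. Qed.

Lemma mem_splice x p q : x \in path_vertices p ->
  x \in path_vertices (splice x p q).
Proof. by move=> xp; rewrite splice_vertices mem_cat mem_head_position. Qed.

Lemma vertices_cut x p :
  path_vertices p = (p.1 :: map tgt (take (position p x) p.2))
    ++ map tgt (drop (position p x) p.2).
Proof. by rewrite /= -map_cat cat_take_drop. Qed.

(** The initial part of [p] up to its first visit to [x] is kept, so a second exchange at [x] cuts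
    at the same places and undoes the first. *)
Lemma position_splice x p q : x \in path_vertices p ->
  position (splice x p q) x = position p x.
Proof.
move=> xp; rewrite {1}/position splice_vertices index_cat mem_head_position //.
by rewrite [RHS]/position (vertices_cut x p) index_cat mem_head_position.
Qed.

Lemma spliceK x p q : x \in path_vertices p -> x \in path_vertices q ->
  splice x (splice x p q) (splice x q p) = p.
Proof.
move=> xp xq; rewrite {1}/splice !position_splice //=.
rewrite take_size_cat ?size_takel ?position_le //.
rewrite drop_size_cat ?size_takel ?position_le //.
by rewrite cat_take_drop -surjective_pairing.
Qed.

Lemma count_splice x p q y :
  (count_mem y (path_vertices (splice x p q))
   + count_mem y (path_vertices (splice x q p)) =
   count_mem y (path_vertices p) + count_mem y (path_vertices q))%N.
Proof.
rewrite !splice_vertices (vertices_cut x p) (vertices_cut x q) !count_cat.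
lia.
Qed.

Lemma weight_splice (R : comPzRingType) (w : edge G -> R) x p q :
  path_weight w (splice x p q) * path_weight w (splice x q p) =
    path_weight w p * path_weight w q.
Proof.
rewrite /path_weight /= !big_cat /=.
rewrite -[in RHS](cat_take_drop (position p x) p.2).
rewrite -[in RHS](cat_take_drop (position q x) q.2) !big_cat /=; ring.
Qed.

(** The edges between two visits to a vertex would form a closed path of positive length. *)
Lemma path_vertices_uniq p b : acyclic G -> joins p.1 p.2 b ->
  uniq (path_vertices p).
Proof.
move=> acy; case: p => a s; rewrite /path_vertices /=.
elim: s a => //= e s IHs a /andP[/eqP ea jb]; rewrite IHs // andbT.
apply/negP => aS.
pose q : dpath G := (tgt e, s).
have := acy a (e :: take (position q a) s); rewrite /= ea eqxx /=.
suff h : joins (tgt e) (take (position q a) s) a by move=> /(_ h).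
move: jb; rewrite -{1}(cat_take_drop (position q a) s) joins_cat.
by rewrite (last_position (p := q)) // => /andP[].
Qed.
End Splice.

(** * The sign-reversing involution on tuples of paths *)

Section SwapHeads.
Variables (G : digraph) (m : nat).
Implicit Types (P : {ffun 'I_m -> dpath G}) (x : vertex G).

(** Initial parts are exchanged and end points stay in place, so only the permutation of the
    starting points changes, by a transposition. *)
Definition swap_heads x (k l : 'I_m) P : {ffun 'I_m -> dpath G} :=
  [ffun i => if i == k then splice x (P l) (P k)
             else if i == l then splice x (P k) (P l) else P i].

Definition multiplicity P x : nat :=
  \sum_i count_mem x (path_vertices (P i)).

Definition meet_point P : option (vertex G) :=
  if pselect (exists x, 1 < multiplicity P x)%N is left h
  then Some (xchoose h) else None.

Definition meet_pair P x : option ('I_m * 'I_m) :=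
  [pick kl : 'I_m * 'I_m | [&& kl.1 != kl.2, x \in path_vertices (P kl.1)
                            & x \in path_vertices (P kl.2)]].

(* meet_point depends only on the multiplicities and meet_pair only on which
   paths pass through x; both data are invariant under the swap, so that
   swapping is an involution. *)
Definition swap (z : 'S_m * {ffun 'I_m -> dpath G}) :=
  if meet_point z.2 is Some x then
    if meet_pair z.2 x is Some (k, l) then
      ((tperm k l * z.1)%g, swap_heads x k l z.2)
    else z
  else z.

Section OneSwap.
Variables (P : {ffun 'I_m -> dpath G}) (x : vertex G) (k l : 'I_m).
Hypotheses (neq_kl : k != l) (xk : x \in path_vertices (P k))
  (xl : x \in path_vertices (P l)).

Lemma swap_headsK : swap_heads x k l (swap_heads x k l P) = P.
Proof.
have neq_lk : (l == k) = false by rewrite eq_sym (negPf neq_kl).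
apply/ffunP=> i; rewrite !ffunE !eqxx neq_lk.
have [->|_] := eqVneq i k; first by rewrite spliceK.
by have [->|//] := eqVneq i l; rewrite spliceK.
Qed.

Lemma big_pair (S : Type) (idx : S) (op : Monoid.com_law idx) (F : 'I_m -> S) :
  \big[op/idx]_i F i =
    op (op (F k) (F l)) (\big[op/idx]_(i | (i != k) && (i != l)) F i).
Proof.
rewrite (bigD1 k) //= (bigD1 l) 1?eq_sym //= Monoid.mulmA.
by congr (op _ _); apply: eq_bigl => i.
Qed.

Lemma swap_heads_other i : (i != k) && (i != l) -> swap_heads x k l P i = P i.
Proof. by move=> /andP[/negPf ik /negPf il]; rewrite ffunE ik il. Qed.

Lemma swap_heads_k : swap_heads x k l P k = splice x (P l) (P k).
Proof. by rewrite ffunE eqxx. Qed.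

Lemma swap_heads_l : swap_heads x k l P l = splice x (P k) (P l).
Proof. by rewrite ffunE eqxx eq_sym (negPf neq_kl). Qed.

Lemma multiplicity_swap : multiplicity (swap_heads x k l P) = multiplicity P.
Proof.
apply/funext=> y; rewrite /multiplicity !big_pair swap_heads_k swap_heads_l /=.
rewrite count_splice; congr addn; first exact: addnC.
by apply: eq_bigr => i /swap_heads_other ->.
Qed.

Lemma weight_swap (R : comPzRingType) (w : edge G -> R) :
  tuple_weight w (swap_heads x k l P) = tuple_weight w P.
Proof.
rewrite /tuple_weight !big_pair swap_heads_k swap_heads_l /= weight_splice.
rewrite (mulrC (path_weight w (P l))).
by congr (_ * _); apply: eq_bigr => i /swap_heads_other ->.
Qed.

Lemma mem_swap i :
  (x \in path_vertices (swap_heads x k l P i)) = (x \in path_vertices (P i)).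
Proof.
have [->|ik] := eqVneq i k; first by rewrite swap_heads_k xk mem_splice.
have [->|il] := eqVneq i l; first by rewrite swap_heads_l xl mem_splice.
by rewrite swap_heads_other ?ik.
Qed.

Lemma meet_point_swap : meet_point (swap_heads x k l P) = meet_point P.
Proof. by rewrite /meet_point multiplicity_swap. Qed.

Lemma meet_pair_swap : meet_pair (swap_heads x k l P) x = meet_pair P x.
Proof. by apply: eq_pick => kl; rewrite /= !mem_swap. Qed.

Lemma swap_heads_paths (u v : 'I_m -> vertex G) (s : 'S_m) :
  (forall i, paths (u (s i)) (v i) (P i)) ->
  forall i, paths (u ((tperm k l * s)%g i)) (v i) (swap_heads x k l P i).
Proof.
move=> Ps i; rewrite permM.
have [->|ik] := eqVneq i k.
  by rewrite tpermL swap_heads_k; exact: splice_paths (Ps l) (Ps k).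
have [->|il] := eqVneq i l.
  by rewrite tpermR swap_heads_l; exact: splice_paths (Ps k) (Ps l).
by rewrite tpermD 1?eq_sym // swap_heads_other ?ik.
Qed.

Lemma swap_heads_intersecting : ~ nonintersecting (swap_heads x k l P).
Proof. by move=> /(_ k l neq_kl); apply; exists x; rewrite !mem_swap. Qed.
End OneSwap.

(** In an acyclic graph a path visits a vertex at most once, so a multiplicity above 1 comes from
    two different paths and [swap] takes its nontrivial branch. *)
Lemma swapP (z : 'S_m * {ffun 'I_m -> dpath G}) (u v : 'I_m -> vertex G) :
  acyclic G -> (forall i, paths (u i) (v i) (z.2 i)) -> ~ nonintersecting z.2 ->
  exists x k l, [/\ k != l, x \in path_vertices (z.2 k),
    x \in path_vertices (z.2 l), meet_point z.2 = Some x
    & meet_pair z.2 x = Some (k, l)].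
Proof.
case: z => s P /= acy Ps nni.
have ex : exists x, (1 < multiplicity P x)%N.
  apply: contrapT => /forallNP none; apply: nni => k l neq_kl [x [xk xl]].
  apply: (none x); rewrite /multiplicity (big_pair neq_kl) /=.
  move: xk xl; rewrite -!has_pred1 !has_count => xk xl.
  by apply: leq_trans (leq_addr _ _); exact: (leq_add xk xl).
have [x mx] : exists2 x, meet_point P = Some x & (1 < multiplicity P x)%N.
  rewrite /meet_point; case: pselect => // h; exists (xchoose h) => //.
  exact: (xchooseP h).
move=> Px.
have cnt i : count_mem x (path_vertices (P i)) = (x \in path_vertices (P i)).
  by rewrite count_uniq_mem //; case: (Ps i) => _ /(path_vertices_uniq acy).
have card : (1 < #|[set i | x \in path_vertices (P i)]%SET|)%N.
  rewrite -sum1dep_card big_mkcond /=; move: Px; rewrite /multiplicity.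
  by rewrite (eq_bigr _ (fun i _ => cnt i)).
have /card_gt1P[k [l [kP lP neq_kl]]] := card.
rewrite !finset.in_set in kP lP.
case E : (meet_pair P x) => [[k' l']|].
  exists x, k', l'; move: E; rewrite /meet_pair; case: pickP => // -[a b] /=.
  by move=> /and3P[? ? ?] [<- <-].
move: E; rewrite /meet_pair; case: pickP => // /(_ (k, l)) /=.
by rewrite neq_kl kP lP.
Qed.
End SwapHeads.

(** * Lindstrom's lemma *)

Section Lindstrom.
Variables (R : comPzRingType) (G : digraph) (w : edge G -> R) (m : nat).
Variables (u v : 'I_m -> vertex G).
Hypotheses (acy : acyclic G)
  (sum_uv : forall i k, summable (path_weight w) (paths (u i) (v k))).

Definition path_tuples (s : 'S_m) : set {ffun 'I_m -> dpath G} :=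
  [set P | forall k, paths (u (s k)) (v k) (P k)].

Definition ni_tuples : set {ffun 'I_m -> dpath G} := [set P | nonintersecting P].

Definition intersecting (b : bool) : set ('S_m * {ffun 'I_m -> dpath G}) :=
  [set z | odd_perm z.1 = b /\ (path_tuples z.1 `&` ~` ni_tuples) z.2].

Lemma summable_path_tuples (s : 'S_m) :
  summable (@tuple_weight R G w m) (path_tuples s).
Proof. by have [] := GF_prod (fun k => sum_uv (s k) k). Qed.

Lemma swap_intersecting (b : bool) (z : 'S_m * {ffun 'I_m -> dpath G}) :
  intersecting b z ->
  [/\ intersecting (~~ b) (swap z), swap (swap z) = z
    & tuple_weight w (swap z).2 = tuple_weight w z.2].
Proof.
case: z => s P [/= odds [Ps nni]].
have [x [k [l [/= kl xk xl Px Pkl]]]] := @swapP _ _ (s, P) _ _ acy Ps nni.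
have -> : swap (s, P) = ((tperm k l * s)%g, swap_heads x k l P).
  by rewrite /swap /= Px Pkl.
split; last exact: weight_swap.
  split=> /=; first by rewrite odd_permM odd_tperm kl odds.
  by split; [exact: swap_heads_paths|exact: swap_heads_intersecting].
rewrite /swap /= meet_point_swap // Px meet_pair_swap // Pkl.
by rewrite swap_headsK // mulgA tperm2 mul1g.
Qed.

Lemma GF_intersecting (b : bool) :
  GF (fun z => tuple_weight w z.2) (intersecting b) =
    \sum_(s : 'S_m | odd_perm s == b)
      GF (@tuple_weight R G w m) (path_tuples s `&` ~` ni_tuples).
Proof.
rewrite GF_pair => [|s]; last first.
  by apply: summable_sub (summable_path_tuples s) => P [_ []].
rewrite [RHS]big_mkcond; apply: eq_bigr => s _; rewrite /intersecting /=.
case: eqP => [odds|nodd].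
  by congr GF; apply/seteqP; split=> [P [_]|P].
by rewrite /GF fsbig1 // => P [].
Qed.

(** [swap] is a weight-preserving bijection between the intersecting tuples of odd and of even
    permutations. *)
Lemma sum_intersecting :
  \sum_(s : 'S_m) (-1) ^+ s *
    GF (@tuple_weight R G w m) (path_tuples s `&` ~` ni_tuples) = 0.
Proof.
rewrite (bigID (@odd_perm _)) /=.
under eq_bigr => s -> do rewrite mulN1r.
rewrite sumrN.
under [X in _ + X]eq_bigr => s /negPf -> do rewrite mul1r.
apply/eqP; rewrite addrC subr_eq0; apply/eqP.
transitivity (GF (fun z => tuple_weight w z.2) (intersecting false)).
  by rewrite GF_intersecting; apply: eq_bigl => s; rewrite eqbF_neg.
transitivity (GF (fun z => tuple_weight w z.2) (intersecting true)); last first.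
  by rewrite GF_intersecting; apply: eq_bigl => s; rewrite eqb_id.
rewrite /GF (@reindex_fsbig _ _ _ _ _ (@swap G m) (intersecting true)).
  apply: eq_fsbigr => z /set_mem zi.
  by have [] := swap_intersecting zi.
split=> [z zi|z z'|z zi].
- by have [] := swap_intersecting zi.
- move=> /set_mem zi /set_mem zi' eqz.
  have [_ <- _] := swap_intersecting zi; have [_ <- _] := swap_intersecting zi'.
  by rewrite eqz.
by have [zi' zz _] := swap_intersecting zi; exists (swap z).
Qed.

(** Adding the vanishing sum over intersecting tuples completes each term to all path tuples, whose
    sum factors into a term of the Leibniz expansion of the transposed matrix. *)
Lemma Lindstrom :
  \sum_(s : 'S_m) (-1) ^+ s *
    GF (@tuple_weight R G w m) (path_tuples s `&` ni_tuples) =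
    \det (\matrix_(i, k) GF (path_weight w) (paths (u i) (v k))).
Proof.
rewrite -[LHS]addr0 -[X in _ + X]sum_intersecting -big_split -det_tr /=.
apply: eq_bigr => s _; rewrite -mulrDr -GF_setID; last exact: summable_path_tuples.
congr (_ * _); have [_ <-] := GF_prod (fun k => sum_uv (s k) k).
by apply: eq_bigr => k _; rewrite !mxE.
Qed.
End Lindstrom.

(** * Nonintersecting paths with free end points, and compatibility *)

Section Main.
Variables (R : comPzRingType) (G : digraph) (w : edge G -> R) (m n : nat).
Variables (u : 'I_m -> vertex G) (v : 'I_n -> vertex G).
Hypotheses (acy : acyclic G)
  (sum_uv : forall i k, summable (path_weight w) (paths (u i) (v k))).

Lemma GF_niE (s : 'S_m) :
  GF_ni w (fun k => u (s k)) v =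
    \sum_(j : {ffun 'I_m -> 'I_n} | increasing j)
      GF (@tuple_weight R G w m) (path_tuples u (v \o j) s `&` @ni_tuples G m).
Proof.
have sub j : [set P | nipaths (fun k => u (s k)) v (j, P)] `<=`
    path_tuples u (v \o j) s by move=> P [].
rewrite /GF_ni GF_pair => [|j]; last first.
  apply: summable_sub (sub j) _.
  exact: (@summable_path_tuples _ _ w _ u (v \o j) (fun i k => sum_uv i (j k)) s).
rewrite [RHS]big_mkcond; apply: eq_bigr => j _; case: increasingP => incr.
  by congr GF; apply/seteqP; split=> [P []|P []].
by rewrite /GF fsbig1 // => P [].
Qed.

(** Once the end point indices [j] are fixed, Lindstrom's lemma for the targets [v \o j] gives the
    minor on the columns [j]. *)
Lemma sum_GF_ni :
  \sum_(s : 'S_m) (-1) ^+ s * GF_ni w (fun k => u (s k)) v =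
    minor_sum (path_matrix w u v).
Proof.
under eq_bigr => s _ do rewrite GF_niE mulr_sumr.
rewrite exchange_big; apply: eq_bigr => j _ /=.
rewrite (Lindstrom acy (fun i k => sum_uv i (j k))); congr (\det _).
by apply/matrixP=> i k; rewrite !mxE.
Qed.

End Main.

(** The values of [s] in order form a sorted list with the same members as the enumeration, hence
    equal to it. *)
Lemma homo_perm1 (m : nat) (s : 'S_m) :
  {homo s : k l / (k < l)%N} -> s = 1%g.
Proof.
move=> incr; pose j := [ffun k => s k].
have eqs : index_seq j = enum 'I_m.
  apply: (irr_sorted_eq (@ltn_ord_trans m)).
  - by move=> x; exact: ltnn.
  - rewrite sorted_index_seq; apply/increasingP=> k l; rewrite !ffunE.
    exact: incr.
  - exact: sorted_enum_ord.
  move=> x; rewrite mem_enum; apply/mapP; exists (s^-1%g x).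
    by rewrite mem_enum.
  by rewrite ffunE permKV.
apply/permP=> k; rewrite perm1.
by have := nth_index_seq j k k; rewrite eqs nth_ord_enum ffunE.
Qed.

(** An inversion of [s] yields two paths that compatibility forces to meet; a permutation admitting
    a nonintersecting tuple is therefore increasing, hence trivial. *)
Lemma GF_ni_compatible (R : comPzRingType) (G : digraph) (w : edge G -> R)
    (m n : nat) (u : 'I_m -> vertex G) (v : 'I_n -> vertex G) (s : 'S_m) :
  compatible u v -> s != 1%g -> GF_ni w (fun k => u (s k)) v = 0.
Proof.
move=> compat /eqP s1; rewrite /GF_ni /GF fsbig1 // => -[j P] [/= incr Ps ni].
case: s1; apply: homo_perm1 => k l lt_kl; rewrite ltnNge leq_eqVlt negb_or.
have neq : k != l by rewrite -val_eqE /= ltn_eqF.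
rewrite val_eqE (inj_eq perm_inj) eq_sym neq /=; apply/negP => lt_s.
apply: (ni l k); first by rewrite eq_sym.
exact: compat lt_s (incr _ _ lt_kl) _ _ (Ps l) (Ps k).
Qed.

Theorem theorem1p3 (R : comPzRingType) (G : digraph) (w : edge G -> R)
    (m n : nat) (u : 'I_m -> vertex G) (v : 'I_n -> vertex G)
    (G_acyclic : acyclic G) (G_locally_finite : locally_finite G)
    (le_mn : (m <= n)%N)
    (GF_defined : forall (i : 'I_m) (j : 'I_n),
       summable (path_weight w) (paths (u i) (v j))) :
  let M := path_matrix w u v in
  let D := \det (M *m U_mx R n *m M^T) in
  let D' := \det (M *m (U_mx R n)^T *m M^T) in
  ((\sum_(s : 'S_m) (-1) ^+ s * GF_ni w (fun k => u (s k)) v) ^+ 2 = D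
   /\ D = D')
  /\ (compatible u v -> GF_ni w u v ^+ 2 = D /\ D = D').
Proof.
move=> M D D'.
have DD' : D = D' by rewrite /D -det_tr !trmx_mul trmxK mulmxA.
have sumD : (\sum_(s : 'S_m) (-1) ^+ s * GF_ni w (fun k => u (s k)) v) ^+ 2 = D.
  by rewrite sum_GF_ni // -det_U.
split=> // compat; split=> //; rewrite -sumD (bigD1 1%g) //= odd_perm1 mul1r.
rewrite big1 ?addr0 => [|s s1]; last by rewrite GF_ni_compatible ?mulr0.
by congr (GF_ni w _ v ^+ 2); apply/funext=> k; rewrite perm1.
Qed.
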